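(* Let $G$ be a finite simple graph, not isomorphic to $K_2$. If $G$ is traceable, i.e. has a Hamiltonian path, then $OD'^-(G)=1$.
   Context: Write $[k]=\{1,\ldots,k\}$. An orientation of a graph $G$ is a digraph $\overrightarrow{G}$ obtained from $G$ by replacing each edge $xy$ with exactly one of the arcs $\overrightarrow{xy}$, $\overrightarrow{yx}$. Automorphisms of a digraph preserve arcs together with their directions. An arc colouring with colours from $[k]$ (no properness required) is distinguishing if the only automorphism of the digraph preserving the colours of all arcs is the identity; the distinguishing index $D'(\overrightarrow{G})$ is the least integer $k\ge1$ for which a distinguishing arc colouring with colours from $[k]$ exists. Define $OD'^-(G)=\min D'(\overrightarrow{G})$ over all orientations $\overrightarrow{G}$ of $G$. An orientation is rigid if its only automorphism is the identity; thus $OD'^-(G)=1$ precisely when $G$ admits a rigid orientation. *)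

(* Defs.v *)
From mathcomp Require Import all_boot all_fingroup.

Set Implicit Arguments.
Unset Strict Implicit.
Unset Printing Implicit Defensive.

(* Graphs and digraphs on a finite vertex type are given by their adjacency
   relation; a simple graph is a symmetric irreflexive relation. *)

Definition graph_iso (T U : finType) (e : rel T) (e' : rel U) : Prop :=
  exists2 f : T -> U, bijective f & forall x y, e' (f x) (f y) = e x y.

Definition complete_graph (n : nat) : rel 'I_n := fun i j => i != j.

Definition traceable (T : finType) (e : rel T) : Prop :=
  exists x p, [/\ path e x p, uniq (x :: p) & forall y, y \in x :: p].

Definition orientation (T : finType) (e a : rel T) : Prop :=
  (forall x y, a x y -> e x y) /\ (forall x y, e x y -> a x y (+) a y x).

Definition digraph_aut (T : finType) (a : rel T) (s : {perm T}) : Prop :=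
  forall x y, a (s x) (s y) = a x y.

(* Only the values of [c] on arcs matter. *)
Definition arc_colouring (T : finType) (a : rel T) (k : nat)
    (c : T -> T -> nat) : Prop :=
  forall x y, a x y -> 1 <= c x y <= k.

Definition distinguishing (T : finType) (a : rel T) (c : T -> T -> nat) : Prop :=
  forall s : {perm T}, digraph_aut a s ->
    (forall x y, a x y -> c (s x) (s y) = c x y) -> s = 1%g.

Definition has_distinguishing_colouring (T : finType) (a : rel T) (k : nat) :
    Prop :=
  exists2 c, arc_colouring a k c & distinguishing a c.

(* [dist_index a k] reads D'(a) = k.  It is a relation because D'(a) may fail
   to exist: with two isolated vertices no arc colouring is distinguishing. *)
Definition dist_index (T : finType) (a : rel T) (k : nat) : Prop :=
  [/\ 1 <= k, has_distinguishing_colouring a k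
    & forall j, 1 <= j -> has_distinguishing_colouring a j -> k <= j].

(* [OD_minus e k] reads OD'^-(e) = k; the minimum is over the orientations
   whose distinguishing index exists. *)
Definition OD_minus (T : finType) (e : rel T) (k : nat) : Prop :=
  (exists2 a, orientation e a & dist_index a k) /\
  (forall a j, orientation e a -> dist_index a j -> k <= j).

(* Main.v *)
Require Import Defs.
From mathcomp Require Import all_boot all_fingroup.

(** Listing the vertices along a Hamiltonian path [s] and orienting every edge
    from its earlier to its later end gives an acyclic digraph in which [s] is
    a directed path. Such a digraph has only one Hamiltonian directed path:
    positions in [s] strictly increase along any directed path, so a directed
    path through all vertices is the enumeration of the vertices by increasing
    position, which is [s] itself ([forward_hamiltonian_path_unique]). An
    automorphism maps [s] to a Hamiltonian directed path, hence to itself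
    vertex by vertex, so the orientation is rigid
    ([forward_orientation_rigid]), and the constant colouring of a rigid
    digraph is distinguishing. *)

Definition forward {T : finType} (e : rel T) (s : seq T) : rel T :=
  fun x y => e x y && (index x s < index y s).

Lemma forward_orientation {T : finType} (e : rel T) (s : seq T) :
  symmetric e -> irreflexive e -> (forall y, y \in s) ->
  orientation e (forward e s).
Proof.
move=> e_sym e_irr s_all; split=> [x y /andP[]//|x y exy].
rewrite /forward [e y x]e_sym exy /=.
case: ltngtP => // /(index_inj x (s_all x) (s_all y)) eq_xy.
by rewrite eq_xy e_irr in exy.
Qed.

Lemma forward_sorted {T : finType} (e : rel T) (s : seq T) :
  uniq s -> sorted e s -> sorted (forward e s) s.
Proof.
case: s => // x p s_uniq /(pathP x) e_p; apply/(pathP x) => i lt_ip.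
rewrite /forward e_p //.
(* Both ends are read off [x :: p], whose entries have known positions. *)
rewrite -[nth x p i]/(nth x (x :: p) i.+1).
by rewrite !index_uniq //= ltnW.
Qed.

(** The arc relation may fail to be transitive, so it is replaced by the strict
    order on positions, which contains it. That order is transitive and
    irreflexive, and hence lists a given set of vertices in one way only. *)
Lemma forward_hamiltonian_path_unique {T : finType} (e : rel T)
    (s t : seq T) :
  uniq s -> sorted e s -> s =i t -> sorted (forward e s) t -> t = s.
Proof.
move=> s_uniq e_s eq_st a_t.
have increasing u : sorted (forward e s) u ->
    sorted (relpre (index^~ s) ltn) u.
  by apply: sub_sorted => x y /andP[].
apply: (@irr_sorted_eq _ (relpre (index^~ s) ltn)).
- by move=> y x z /=; apply: ltn_trans.
- by move=> x /=; apply: ltnn.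
- exact: increasing.
- exact/increasing/forward_sorted.
- by move=> x; rewrite eq_st.
Qed.

Lemma forward_orientation_rigid {T : finType} (e : rel T) (s : seq T)
    (f : {perm T}) :
  uniq s -> sorted e s -> (forall y, y \in s) ->
  digraph_aut (forward e s) f -> f = 1%g.
Proof.
move=> s_uniq e_s s_all f_aut.
have fs_all : s =i map f s.
  by move=> y; rewrite s_all -[y](permKV f) map_f ?s_all.
have fs_path : sorted (forward e s) (map f s).
  by rewrite sorted_map (eq_sorted f_aut) forward_sorted.
have /eq_in_map fs_id : map f s = map id s.
  by rewrite map_id; apply: forward_hamiltonian_path_unique fs_path.
by apply/permP => y; rewrite perm1 fs_id.
Qed.

Lemma rigid_dist_index {T : finType} (a : rel T) :
  (forall f : {perm T}, digraph_aut a f -> f = 1%g) -> dist_index a 1.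
Proof.
move=> a_rigid; split=> //.
by exists (fun _ _ => 1) => // f /a_rigid.
Qed.

Theorem theorem10 (T : finType) (e : rel T)
    (e_sym : symmetric e) (e_irr : irreflexive e)
    (e_notK2 : ~ graph_iso e (@complete_graph 2))
    (e_traceable : traceable e) :
  OD_minus e 1.
Proof.
split; last by move=> a j _ [].
case: e_traceable => x [p [e_p s_uniq s_all]].
exists (forward e (x :: p)); first exact: forward_orientation.
by apply: rigid_dist_index => f; apply: forward_orientation_rigid.
Qed.
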